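(* Let $X$ be a nonsingular (projective, complex) surface of general type. Let $m_1,m_2\in\{3,4,5\}$ and $t_1,t_2\in\mathbb{Q}_+$ be such that $$1+t_1+t_2<(m_1+m_2-3)\,\theta_{1,m_1+m_2-3}.$$ Then, for all sections $P_i\in H^0(X,E_{2,m_i}T^\star_X\otimes\mathcal{O}_X(t_iK_X))$, $i=1,2$, with $\beta_i=\Phi(P_i)$, the section $$\beta_1P_2-\beta_2P_1\in H^0\big(X,E_{2,m_1+m_2-3}T^\star_X\otimes\mathcal{O}_X((1+t_1+t_2)K_X)\big)$$ vanishes.
   Context: $K_X$ is the canonical divisor of $X$. For a surface $X$, $E_{2,m}T^\star_X$ is the (locally free) sheaf of invariant jet differentials of order $2$ and weighted degree $m$: its local sections are polynomial differential operators acting on germs of curves $f=(f_1,f_2):(\mathbb{C},0)\to X$ of the form $$P(f)=\sum_{\alpha_1+\alpha_2+3j=m}a_{\alpha_1\alpha_2j}(f)\,(f_1')^{\alpha_1}(f_2')^{\alpha_2}(f_1'f_2''-f_1''f_2')^j$$ with holomorphic coefficients. Here $\oplus_m E_{2,m}T^\star_X$ is a graded algebra, $S^mT^\star_X\subset E_{2,m}T^\star_X$ consists of the operators with only $j=0$ terms, and $E_{2,m}T_X^\star=S^mT_X^\star$ for $m\le 2$. For $m=3,4,5$ the exponent $j$ only takes the values $0,1$, and there is an exact sequence $$0\to S^mT^\star_X\to E_{2,m}T^\star_X\xrightarrow{\ \Phi\ }E_{2,m-3}T^\star_X\otimes K_X\to 0,$$ where, if $P=\sum_{|\alpha|=m}a_\alpha(f')^\alpha+\sum_{|\alpha|=m-3}b_\alpha(f')^\alpha(f_1'f_2''-f_2'f_1'')$,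 then $\Phi(P)=\sum_{|\alpha|=m-3}b_\alpha(f')^\alpha$. The same letter $\Phi$ denotes the map obtained after tensoring with $\mathcal{O}_X(tK_X)$; thus $\beta_i=\Phi(P_i)\in H^0(X,S^{m_i-3}T^\star_X\otimes\mathcal{O}_X((1+t_i)K_X))$. $\theta_{1,m}$ is the smallest rational number $t/m$ (with $t\in\mathbb{Q}$ such that $tK_X$ is an integral divisor) for which $H^0(X,S^mT^\star_X\otimes\mathcal{O}(tK_X))$ contains a nonzero section. Whenever $\mathcal{O}_X(tK_X)$ is written with $t$ rational, $tK_X$ is assumed to be an integral divisor. $\mathbb{Q}_+$ denotes the nonnegative rationals. *)

(* Defs.v *)
(* Everything is done analytically, over the complex numbers R[i] with
   R : realType: a nonsingular projective surface is a compact connected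
   complex surface holomorphically embedded in some P^N(C). *)
From HB Require Import structures.
From mathcomp Require Import all_boot all_order all_algebra.
From mathcomp Require Import all_classical all_reals all_analysis.
From mathcomp Require Import complex.
Set Implicit Arguments.
Unset Strict Implicit.
Unset Printing Implicit Defensive.
Import Order.TTheory GRing.Theory Num.Theory.
Import numFieldNormedType.Exports.
Local Open Scope classical_set_scope.
Local Open Scope ring_scope.

(* The complex numbers, packaged as a numFieldType so that the normed module
   structures of MathComp-Analysis are inferred. *)
Definition complexes (R : realType) : numFieldType := R[i].

(** * Complex surfaces *)

(* Raw data of an atlas; [coordV a] is only meaningful on the image of
   [dom a].  The axioms are in [projective_surface] below. *)
Record surface (R : realType) := Surface {
  points :> topologicalType;
  chart : Type;
  dom : chart -> set points;
  coord : chart -> points -> 'rV[complexes R]_2;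
  coordV : chart -> 'rV[complexes R]_2 -> points }.

Section Surface.
Context (R : realType) (X : surface R).
Local Notation C := (complexes R).
Implicit Types (a b : chart X) (U : set X) (x : X).

(* [g] is holomorphic on the open set [U]: complex (Frechet) differentiable
   at every point of [U], read in every chart. *)
Definition holo U (g : X -> C) :=
  forall a x, U x -> dom a x -> differentiable (g \o coordV a) (coord a x).

Definition partial a (j : 'I_2) (g : X -> C) x : C :=
  'D_(delta_mx 0 j : 'rV[C]_2) (g \o coordV a) (coord a x).

Definition coordi a (l : 'I_2) x : C := coord a x 0 l.

(* Jacobian determinant of [coord b] with respect to [coord a], i.e. the
   function such that  dz^b_0 /\ dz^b_1 = (jac a b) dz^a_0 /\ dz^a_1. *)
Definition jac a b x : C :=
  \det (\matrix_(j < 2, l < 2) partial a j (coordi b l) x).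

(* A holomorphic embedding of X into P^N(C): [F x] is a vector of homogeneous
   coordinates of the image of [x], chosen without any regularity; the map to
   P^N is holomorphic and immersive because near each point [F] is
   proportional to a holomorphic [G] for which G, dG/dz_0, dG/dz_1 are
   linearly independent. *)
Definition projective :=
  exists (N : nat) (F : X -> 'rV[C]_N.+1),
  [/\ forall x, F x != 0,
      forall x y (c : C), F x = c *: F y -> x = y &
      forall x, exists (U : set X) (G : X -> 'rV[C]_N.+1),
        [/\ open U, U x,
            forall y, U y -> exists2 c : C, c != 0 & G y = c *: F y,
            forall l, holo U (fun y => G y 0 l) &
            forall a, dom a x ->
              row_free (col_mx (G x)
                (\matrix_(j < 2, l < N.+1) partial a j (fun y => G y 0 l) x))]].

(* [surf_holo] says that the coordinate changes are holomorphic, read on the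
   components of the coordinates.  By Cauchy's theory [surf_holo_partial]
   follows from it, so this field is no restriction. *)
Record projective_surface : Prop := {
  surf_cover : forall x, exists a, dom a x;
  surf_open : forall a, open (dom a);
  surf_coordK : forall a x, dom a x -> coordV a (coord a x) = x;
  surf_open_image : forall a, open (coord a @` dom a);
  surf_coord_cont : forall a x, dom a x -> {for x, continuous (coord a)};
  surf_coordV_cont : forall a x, dom a x ->
    {for coord a x, continuous (coordV a)};
  surf_holo : forall a l, holo (dom a) (coordi a l);
  surf_holo_partial : forall a b j l,
    holo (dom a `&` dom b) (partial a j (coordi b l));
  surf_hausdorff : hausdorff_space X;
  surf_compact : compact [set: X];
  surf_connected : connected [set: X];
  surf_nonempty : [set: X] !=set0;
  surf_projective : projective }.

(** * Line bundles and divisors *)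

(* A line bundle given by a cocycle: a section is a family (s_i) with
   s_i = lb_tr i j * s_j over the intersection of the i-th and j-th open
   sets. *)
Record line_bundle := LineBundle {
  lb_idx : Type;
  lb_cov : lb_idx -> set X;
  lb_tr : lb_idx -> lb_idx -> X -> C }.

Definition section_of (L : line_bundle) (s : lb_idx L -> X -> C) :=
  (forall i, holo (lb_cov i) (s i)) /\
  (forall i j x, lb_cov i x -> lb_cov j x -> s i x = lb_tr i j x * s j x).

(* h^0(X, L) >= d *)
Definition h0_ge (L : line_bundle) (d : nat) :=
  exists s : 'I_d -> lb_idx L -> X -> C,
    (forall l, section_of (s l)) /\
    (forall c : 'I_d -> C,
       (forall i x, lb_cov i x -> \sum_(l < d) c l * s l i x = 0) ->
       forall l, c l = 0).

(* The k-th tensor power of the canonical line bundle, trivialized over each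
   chart by the k-th power of dz_0 /\ dz_1. *)
Definition pluricanonical (k : nat) : line_bundle :=
  LineBundle (@dom R X) (fun a b x => jac a b x ^+ k).

(* K_X is big: h^0(X, k K_X) >= c k^2 for k large. *)
Definition general_type :=
  exists2 c : R, 0 < c & exists k0 : nat, forall k : nat, (k0 <= k)%N ->
    exists2 d : nat, c * k%:R ^+ 2 <= d%:R & h0_ge (pluricanonical k) d.

(* Raw data of a Cartier divisor: over [dcov i] the meromorphic function
   dnum i / dden i is a local equation, and [dtr i j] is the unit
   (dnum i / dden i) / (dnum j / dden j) on overlaps. *)
Record divisor := Divisor {
  didx : Type;
  dcov : didx -> set X;
  dnum : didx -> X -> C;
  dden : didx -> X -> C;
  dtr : didx -> didx -> X -> C }.

(* [g] does not vanish identically on any nonempty open subset of [U] *)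
Definition nowhere_zero_germ U (g : X -> C) :=
  forall V, open V -> V `<=` U -> V !=set0 -> exists2 x, V x & g x != 0.

Definition holo_unit U (u : X -> C) :=
  holo U u /\ forall x, U x -> u x != 0.

Record is_divisor (D : divisor) : Prop := {
  div_open : forall i : didx D, open (dcov i);
  div_cover : forall x, exists i : didx D, dcov i x;
  div_num_holo : forall i : didx D, holo (dcov i) (dnum i);
  div_den_holo : forall i : didx D, holo (dcov i) (dden i);
  div_num_neq0 : forall i : didx D, nowhere_zero_germ (dcov i) (dnum i);
  div_den_neq0 : forall i : didx D, nowhere_zero_germ (dcov i) (dden i);
  div_tr_unit : forall i j : didx D,
    holo_unit (dcov i `&` dcov j) (dtr i j);
  div_trE : forall (i j : didx D) x, dcov i x -> dcov j x ->
    dnum i x * dden j x = dtr i j x * (dnum j x * dden i x) }.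

(* Equality of divisors: the local equations differ by units. *)
Definition div_eq (D E : divisor) :=
  forall (i : didx D) (j : didx E), exists2 u : X -> C,
    holo_unit (dcov i `&` dcov j) u &
    forall x, dcov i x -> dcov j x ->
      dnum i x * dden j x = u x * (dnum j x * dden i x).

Definition div_add (D E : divisor) : divisor :=
  @Divisor (didx D * didx E)
    (fun p => dcov p.1 `&` dcov p.2)
    (fun p x => dnum p.1 x * dnum p.2 x)
    (fun p x => dden p.1 x * dden p.2 x)
    (fun p q x => dtr p.1 q.1 x * dtr p.2 q.2 x).

Definition div_mulz (n : int) (D : divisor) : divisor :=
  @Divisor (didx D) (@dcov D)
    (fun i x => if 0 <= n then dnum i x ^+ `|n| else dden i x ^+ `|n|)
    (fun i x => if 0 <= n then dden i x ^+ `|n| else dnum i x ^+ `|n|)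
    (fun i j x => dtr i j x ^ n).

(* "t K is an integral divisor, namely D": D is a divisor and D = t K in
   Div(X) (x) Q. *)
Definition rat_multiple (t : rat) (K D : divisor) :=
  is_divisor D /\
  exists (p : int) (q : nat),
    [/\ (0 < q)%N, t = p%:~R / q%:R & div_eq (div_mulz q%:Z D) (div_mulz p K)].

(* The line bundle O(D): its sections are the meromorphic functions s such
   that s_i := s * (dnum i / dden i) is holomorphic for all i. *)
Definition OO (D : divisor) : line_bundle := LineBundle (@dcov D) (@dtr D).

(* A nonzero meromorphic 2-form: over [wcov k], contained in the domain of
   the chart [wchart k] with coordinates z, it is
   (wnum k / wden k) dz_0 /\ dz_1. *)
Record mero_form := MeroForm {
  widx : Type;
  wcov : widx -> set X;
  wchart : widx -> chart X;
  wnum : widx -> X -> C;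
  wden : widx -> X -> C }.

Record is_mero_form (w : mero_form) : Prop := {
  form_open : forall k : widx w, open (wcov k);
  form_cover : forall x, exists k : widx w, wcov k x;
  form_chart : forall k : widx w, wcov k `<=` dom (wchart k);
  form_num_holo : forall k : widx w, holo (wcov k) (wnum k);
  form_den_holo : forall k : widx w, holo (wcov k) (wden k);
  form_num_neq0 : forall k : widx w, nowhere_zero_germ (wcov k) (wnum k);
  form_den_neq0 : forall k : widx w, nowhere_zero_germ (wcov k) (wden k);
  form_trE : forall (k l : widx w) x, wcov k x -> wcov l x ->
    wnum k x * wden l x =
    jac (wchart k) (wchart l) x * (wnum l x * wden k x) }.

(* The canonical divisor K_X = div(w).  The isomorphism between the canonical
   line bundle and O(div w), division by w, sends the local generator
   dz_0 /\ dz_1 of the chart [wchart k] to the k-th local generator of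
   O(div w). *)
Definition canonical_divisor (w : mero_form) : divisor :=
  @Divisor (widx w) (@wcov w) (@wnum w) (@wden w)
    (fun k l => jac (wchart k) (wchart l)).

(** * Invariant jet differentials of order 2 *)

(* (Representatives of) germs of holomorphic curves (C,0) -> X. *)
Definition is_curve (f : C -> X) :=
  forall a, dom a (f 0) ->
    \forall t \near (0 : C),
      dom a (f t) /\ differentiable (fun s : C => coord a (f s)) t.

(* First and second derivatives at 0 of the l-th component of f. *)
Definition vel a (f : C -> X) (l : 'I_2) : C :=
  derive1 (fun t : C => coordi a l (f t)) 0.
Definition acc a (f : C -> X) (l : 'I_2) : C :=
  derive1n 2 (fun t : C => coordi a l (f t)) 0.

Definition wronskian a (f : C -> X) : C :=
  vel a f 0 * acc a f 1 - acc a f 0 * vel a f 1.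

(* A differential operator is encoded by its value P(f)(0), for all germs f
   (its value at another parameter is the value at 0 of the translated
   germ). *)
Definition operator := (C -> X) -> C.

(* Over U and in the chart a, P(f) is the sum over p + q + 3 j = m of
   c_{p q j}(f) (f_1')^p (f_2')^q (f_1' f_2'' - f_1'' f_2')^j
   with c_{p q j} holomorphic. *)
Definition jet_expansion (m : nat) a U (c : nat -> nat -> nat -> X -> C)
    (P : operator) :=
  (forall p q j, holo (U `&` dom a) (c p q j)) /\
  (forall f, is_curve f -> U (f 0) -> dom a (f 0) ->
     P f = \sum_(p < m.+1) \sum_(q < m.+1)
             \sum_(j < m.+1 | (p + q + 3 * j == m)%N)
       c p q j (f 0) * vel a f 0 ^+ p * vel a f 1 ^+ q
         * wronskian a f ^+ j).

Definition glued (L : line_bundle) (P : lb_idx L -> operator) :=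
  forall i j f, is_curve f -> lb_cov i (f 0) -> lb_cov j (f 0) ->
    P i f = lb_tr i j (f 0) * P j f.

(* H^0(X, E_{2,m} T*_X (x) L) *)
Definition H0_E (m : nat) (L : line_bundle) : set (lb_idx L -> operator) :=
  [set P | glued P /\
    forall i a, exists c, jet_expansion m a (lb_cov i) c (P i)].

(* H^0(X, S^m T*_X (x) L): only terms with j = 0 *)
Definition H0_S (m : nat) (L : line_bundle) : set (lb_idx L -> operator) :=
  [set P | glued P /\
    forall i a, exists2 c, jet_expansion m a (lb_cov i) c (P i) &
      forall p q j x, (0 < j)%N -> c p q j x = 0].

(* Operators are only evaluated at germs in the open set where they live. *)
Definition zero_section (L : line_bundle) (P : lb_idx L -> operator) :=
  forall i f, is_curve f -> lb_cov i (f 0) -> P i f = 0.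

(* beta = Phi(P), where Phi goes from sections of E_{2,m} (x) O(D) to
   sections of S^{m-3} (x) O(K_X + D), m = 3, 4, 5, with K_X = div(w).  The
   coefficients c are determined by P, hence beta is determined (on the germs
   where it is defined) by P. *)
Definition is_Phi (m : nat) (w : mero_form) (D : divisor)
    (P : lb_idx (OO D) -> operator)
    (beta : lb_idx (OO (div_add (canonical_divisor w) D)) -> operator) :=
  forall (k : widx w) (i : didx D), exists2 c,
    jet_expansion m (wchart k) (wcov k `&` dcov i) c (P i) &
    forall f, is_curve f -> wcov k (f 0) -> dcov i (f 0) ->
      beta (k, i) f =
      \sum_(p < (m - 3).+1) \sum_(q < (m - 3).+1 | (p + q == m - 3)%N)
        c p q 1%N (f 0) * vel (wchart k) f 0 ^+ p
          * vel (wchart k) f 1 ^+ q.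

(* beta1 P2 - beta2 P1, as a family of operators over the cover of the
   divisor K_X + D1 + D2. *)
Definition Phi_bracket (w : mero_form) (D1 D2 : divisor)
    (P1 : lb_idx (OO D1) -> operator) (P2 : lb_idx (OO D2) -> operator)
    (beta1 : lb_idx (OO (div_add (canonical_divisor w) D1)) -> operator)
    (beta2 : lb_idx (OO (div_add (canonical_divisor w) D2)) -> operator) :
    lb_idx (OO (div_add (div_add (canonical_divisor w) D1) D2)) -> operator :=
  fun kij f => let: (k, i, j) := kij in
    beta1 (k, i) f * P2 j f - beta2 (k, j) f * P1 i f.

(** * The threshold theta_{1,m} *)

(* t K is integral and S^m T*_X (x) O(t K) has a nonzero section *)
Definition has_sym_section (K : divisor) (m : nat) (t : rat) :=
  exists2 D : divisor, rat_multiple t K D &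
    exists2 s, @H0_S m (OO D) s & ~ zero_section s.

Definition is_theta1 (K : divisor) (m : nat) (theta : rat) :=
  (exists2 t, has_sym_section K m t & theta = t / m%:R) /\
  (forall t, has_sym_section K m t -> theta <= t / m%:R).

End Surface.

Arguments H0_E {R X} m L P.
Arguments H0_S {R X} m L P.

(* Main.v *)
Require Import Defs.
From HB Require Import structures.
From mathcomp Require Import all_boot all_order all_algebra.
From mathcomp Require Import all_classical all_reals all_analysis.
From mathcomp Require Import complex.
From mathcomp Require Import ring zify.
Set Implicit Arguments.
Unset Strict Implicit.
Unset Printing Implicit Defensive.
Import Order.TTheory GRing.Theory Num.Theory.
Import numFieldNormedType.Exports.
Import Defs.
Local Open Scope classical_set_scope.
Local Open Scope ring_scope.

(** The section beta1 P2 - beta2 P1 has no Wronskian term.  In weighted degree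
3, 4 or 5 a jet differential reads P = A(f') + B(f') W in a chart, with W the
Wronskian of f and A, B binary forms in the velocity of degrees m and m - 3.
By definition beta is B in the trivialization of K_X given by the chart, so
beta1 P2 - beta2 P1 is, up to the factor relating charts,
B1 (A2 + B2 W) - B2 (A1 + B1 W) = B1 A2 - B2 A1: a symmetric differential of
degree m1 + m2 - 3 with values in O(K_X + D1 + D2)
([Phi_bracket_symmetric]).  The divisor K_X + D1 + D2 is (1 + t1 + t2) K_X
([rat_multiple_add]), so if this section were nonzero the minimality of theta
would give (m1 + m2 - 3) theta <= 1 + t1 + t2, against the hypothesis.

What has to be checked is that beta is a section of
S^(m-3) T* (x) O(K_X + D), that is, the transformation rule of the
coefficient B under a change of charts ([wronskian_coefficient]): since
W_b = (jac a b) W_a + (terms of the first jet), one has B_a = (jac a b) B_b.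
This is tested on the curves t |-> x + t v + t^2 d of a chart.  With x and v
fixed, changing d leaves the velocity alone and moves the Wronskian in the
chart b by 2 (jac a b) det(v, d) ([wronskian_test_curve]), so the
comparison of P on two such curves isolates B.  Both sides of the rule depend
on a curve only through its 1-jet, so it then holds for every holomorphic
curve; second derivatives of an arbitrary curve are never compared in two
charts. *)

(** * Derivatives of functions of several variables *)

Section Calculus.
Context (K : numFieldType).

Lemma diff_coord n (x v : 'rV[K]_n) j :
  'd (fun y : 'rV[K]_n => y 0 j : K) x v = v 0 j.
Proof.
pose f (y : 'rV[K]_n) : K := y 0 j.
have f_linear : linear f by move=> c y z; rewrite /f !mxE.
pose F : {linear 'rV[K]_n -> K} :=
  HB.pack f (GRing.isLinear.Build _ _ _ _ f f_linear).
by rewrite -[X in 'd X _]/(F : _ -> _) diff_lin //; exact: coord_continuous.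
Qed.

Context (V : normedModType K).

Lemma differentiable_row n (g : V -> 'rV[K]_n) t :
  (forall j, differentiable (fun s => g s 0 j) t) -> differentiable g t.
Proof.
move=> dg.
have -> : g = \sum_(j < n) (fun s => g s 0 j *: delta_mx 0 j).
  by apply/funext=> s; rewrite fct_sumE [LHS]row_sum_delta.
by apply: differentiable_sum => j; apply: differentiableZl.
Qed.

Lemma derive_comp_row n (phi : 'rV[K]_n -> K) (g : V -> 'rV[K]_n) (u t : V) :
  differentiable g t -> differentiable phi (g t) ->
  'D_u (phi \o g) t =
  \sum_j 'D_(delta_mx 0 j) phi (g t) * 'D_u (fun s => g s 0 j) t.
Proof.
move=> dg dphi; rewrite deriveE; last exact: differentiable_comp.
rewrite diff_comp //= [X in 'd _ _ X]row_sum_delta linear_sum.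
apply: eq_bigr => j _; rewrite linearZ /= deriveE // mulrC; congr (_ * _).
have dc := differentiable_coord (g t) 0 j.
have := deriveE u (differentiable_comp dg dc).
rewrite diff_comp //= => ->; exact/esym/diff_coord.
Qed.

End Calculus.

(** * Changes of charts *)

Lemma det_inverse (K : comNzRingType) n (A B : 'I_n -> 'I_n -> K) :
  (forall j i, \sum_l A j l * B l i = (j == i)%:R) ->
  \det (\matrix_(j, l) A j l) * \det (\matrix_(j, l) B j l) = 1.
Proof.
move=> AB; rewrite -det_mulmx -(det1 _ n); congr (\det _).
by apply/matrixP=> j i; rewrite !mxE -AB; apply: eq_bigr => l _; rewrite !mxE.
Qed.

Section Charts.
Context (R : realType) (X : surface R) (hX : projective_surface X).
Local Notation C := (complexes R).
Implicit Types (a b : chart X) (U : set X) (x : X).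

Lemma near_coordVK a x : dom a x ->
  \forall y \near coord a x, dom a (coordV a y) /\ coord a (coordV a y) = y.
Proof.
move=> ax; apply: (@filterS _ _ _ (coord a @` dom a)).
  by move=> _ [z az <-]; rewrite (surf_coordK hX).
by apply: open_nbhs_nbhs; split; [exact: (surf_open_image hX) | exists x].
Qed.

Lemma near_coordV a U x : dom a x -> open U -> U x ->
  \forall y \near coord a x, U (coordV a y).
Proof.
move=> ax oU Ux; have /(_ U) := surf_coordV_cont hX ax; apply.
by rewrite (surf_coordK hX) //; apply: open_nbhs_nbhs.
Qed.

Lemma holo_continuous U (g : X -> C) x :
  open U -> holo U g -> U x -> {for x, continuous g}.
Proof.
move=> oU hg Ux; have [a ax] := surf_cover hX x.
have cga := differentiable_continuous (hg a x Ux ax).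
have cg : {for x, continuous ((g \o coordV a) \o coord a)}.
  exact: continuous_comp (surf_coord_cont hX ax) cga.
have gE : \forall y \near x, ((g \o coordV a) \o coord a) y = g y.
  apply: filterS (open_nbhs_nbhs (conj (surf_open hX a) ax)) => y ay /=.
  by rewrite (surf_coordK hX).
rewrite /prop_for /continuous_at -(nbhs_singleton gE) /=.
apply: cvg_trans cg; exact: (near_eq_cvg gE).
Qed.

Lemma differentiable_transition a b x : dom a x -> dom b x ->
  differentiable (coord b \o coordV a) (coord a x).
Proof.
by move=> ax bx; apply: differentiable_row => l; apply: (surf_holo hX).
Qed.

Lemma partial_change a b (g : X -> C) j x : dom a x -> dom b x ->
  differentiable (g \o coordV b) (coord b x) ->
  partial a j g x = \sum_l partial b l g x * partial a j (coordi b l) x.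
Proof.
move=> ax bx dg; rewrite {1}/partial.
have gE : \forall y \near coord a x,
    (g \o coordV a) y = ((g \o coordV b) \o (coord b \o coordV a)) y.
  apply: filterS (near_coordV ax (surf_open hX b) bx) => y by_ /=.
  by rewrite (surf_coordK hX).
rewrite (near_eq_derive _ gE) derive_comp_row /=.
- by rewrite (surf_coordK hX).
- exact: differentiable_transition.
- by rewrite (surf_coordK hX).
Qed.

Lemma partial_coordi a i j x : dom a x ->
  partial a j (coordi a i) x = (i == j)%:R.
Proof.
move=> ax; rewrite /partial.
have E : \forall y \near coord a x, (coordi a i \o coordV a) y = y 0 i.
  by apply: filterS (near_coordVK ax) => y [_ ay]; rewrite /= /coordi ay.
rewrite (near_eq_derive _ E) deriveE; last exact: differentiable_coord.
by rewrite diff_coord mxE eqxx.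
Qed.

Lemma partialE a j (g : X -> C) x :
  partial a j g x = 'D_(delta_mx 0 j) (g \o coordV a) (coord a x).
Proof. by []. Qed.

(** By the chain rule the two Jacobian matrices are inverse to each other. *)
Lemma jacM a b x : dom a x -> dom b x -> jac a b x * jac b a x = 1.
Proof.
move=> ax bx; apply: det_inverse => j i.
rewrite eq_sym -(partial_coordi i j ax).
rewrite (partial_change (g := coordi a i) j ax bx);
  last exact: (surf_holo hX i ax bx).
by apply: eq_bigr => l _; exact: mulrC.
Qed.

(** The chain rule, for an arbitrary holomorphic curve f. *)
Lemma vel_change a b f l : is_curve f -> dom a (f 0) -> dom b (f 0) ->
  vel b f l = \sum_j partial a j (coordi b l) (f 0) * vel a f j.
Proof.
move=> hf af bf; rewrite /vel derive1E.
have E : \forall t \near (0 : C), coordi b l (f t) =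
    ((coordi b l \o coordV a) \o (fun t => coord a (f t))) t.
  by apply: filterS (hf a af) => t [aft _] /=; rewrite (surf_coordK hX).
have [_ da] := nbhs_singleton (hf a af).
have dphi := surf_holo hX l bf af.
rewrite (near_eq_derive _ E); apply: etrans (derive_comp_row _ da dphi) _.
by apply: eq_bigr => j _; rewrite derive1E.
Qed.

End Charts.

(** * Test curves with prescribed velocity and acceleration *)

Section Parabola.
Context (K : numFieldType) (n : nat).
Implicit Types (y v d : 'rV[K]_n).

Definition parabola y v d (t : K) : 'rV[K]_n := y + t *: v + t ^+ 2 *: d.

Lemma parabola0 y v d : parabola y v d 0 = y.
Proof. by rewrite /parabola expr0n !scale0r !addr0. Qed.

Lemma is_derive_parabola y v d j (t : K) :
  is_derive t 1 (fun s => parabola y v d s 0 j : K)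
    (v 0 j + 2 * t * d 0 j).
Proof.
have i : is_derive t 1 (id : K -> K) 1 by exact: is_derive_id.
have c (r : K) : is_derive t 1 (cst r : K -> K) 0 by exact: is_derive_cst.
have := is_deriveD (is_deriveD (c (y 0 j)) (is_deriveM i (c (v 0 j))))
  (is_deriveM (is_deriveM i i) (c (d 0 j))).
rewrite [X in is_derive _ _ X _](_ : _ = (fun s => parabola y v d s 0 j)).
  by move=> D; apply: is_derive_eq D _; rewrite /GRing.scale /=; ring.
by apply/funext=> s; rewrite /parabola !mxE.
Qed.

Lemma is_derive_parabola_velocity v d j (t : K) :
  is_derive t 1 (fun s : K => v 0 j + 2 * s * d 0 j : K) (2 * d 0 j).
Proof.
have := is_derive_parabola v (2 *: d) 0 j t.
rewrite !mxE mulr0 addr0; congr (is_derive _ _ _ _).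
by apply/funext=> s; rewrite /parabola !mxE mulr0 addr0 mulrCA mulrA.
Qed.

Lemma differentiable_parabola y v d t : differentiable (parabola y v d) t.
Proof.
apply: differentiable_row => j; apply/derivable1_diffP.
by have [] := is_derive_parabola y v d j t.
Qed.

End Parabola.

Section TestCurves.
Context (R : realType) (X : surface R) (hX : projective_surface X).
Local Notation C := (complexes R).
Implicit Types (a b : chart X) (U : set X) (x : X) (v d : 'rV[C]_2).

(** A curve which is quadratic in the chart a, with 2-jet (x, v, 2 d). *)
Definition test_curve a x v d (t : C) : X :=
  coordV a (parabola (coord a x) v d t).

Lemma test_curve0 a x v d : dom a x -> test_curve a x v d 0 = x.
Proof. by move=> ax; rewrite /test_curve parabola0 (surf_coordK hX). Qed.

Lemma near_parabola (P : set 'rV[C]_2) (y v d : 'rV[C]_2) :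
  (\forall z \near y, P z) -> \forall t \near (0 : C), P (parabola y v d t).
Proof.
move=> Py.
have c := differentiable_continuous (differentiable_parabola y v d 0).
by apply: (c P); rewrite parabola0.
Qed.

Lemma near_test_curve a b x v d : dom a x -> dom b x ->
  \forall t \near (0 : C),
    [/\ dom a (test_curve a x v d t), dom b (test_curve a x v d t) &
        coord a (test_curve a x v d t) = parabola (coord a x) v d t].
Proof.
move=> ax bx.
have n1 := near_parabola v d (near_coordVK hX ax).
have n2 := near_parabola v d (near_coordV hX ax (surf_open hX b) bx).
by apply: filterS2 n1 n2 => t [? ?] ?.
Qed.

Lemma test_curveP a x v d : dom a x -> is_curve (test_curve a x v d).
Proof.
move=> ax b; rewrite test_curve0 // => bx.
apply: filterS (near_test_curve v d ax bx) => t [at_ bt E]; split=> //.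
have dT := differentiable_transition hX at_ bt; rewrite E in dT.
exact: differentiable_comp (differentiable_parabola _ v d t) dT.
Qed.

Lemma derive1_test_curve a b x v d l : dom a x -> dom b x ->
  \forall t \near (0 : C),
    derive1 (fun s : C => coordi b l (test_curve a x v d s)) t =
    \sum_j partial a j (coordi b l) (test_curve a x v d t) *
             (v 0 j + 2 * t * d 0 j).
Proof.
move=> ax bx; apply: filterS (near_test_curve v d ax bx) => t [at_ bt E].
have dphi := surf_holo hX l bt at_; rewrite E in dphi.
rewrite derive1E.
apply: etrans (derive_comp_row _ (differentiable_parabola _ v d t) dphi) _.
apply: eq_bigr => j _; rewrite partialE E.
by have [_ ->] := is_derive_parabola (coord a x) v d j t.
Qed.

Lemma vel_test_curve a b x v d l : dom a x -> dom b x ->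
  vel b (test_curve a x v d) l = \sum_j partial a j (coordi b l) x * v 0 j.
Proof.
move=> ax bx; rewrite /vel (nbhs_singleton (derive1_test_curve v d l ax bx)).
rewrite test_curve0 //.
by apply: eq_bigr => j _; rewrite mulr0 mul0r addr0.
Qed.

(** Second order chain rule.  The terms q j, which contain the second
derivatives of the change of charts, depend on x and v but not on d. *)
Lemma acc_test_curve a b x v l : dom a x -> dom b x ->
  exists q, forall d, acc b (test_curve a x v d) l =
    \sum_j (q j + partial a j (coordi b l) x * (2 * d 0 j)).
Proof.
move=> ax bx.
pose psi j := partial a j (coordi b l) \o coordV a.
exists (fun j =>
  (\sum_i 'D_(delta_mx 0 i) (psi j) (coord a x) * v 0 i) * v 0 j) => d.
have dpsi j : differentiable (psi j) (coord a x).
  exact: (surf_holo_partial hX j l (conj ax bx) ax).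
have psiE j : psi j (coord a x) = partial a j (coordi b l) x.
  by rewrite /psi /= (surf_coordK hX).
have swap (p q r s : C) : p *: q + r *: s = s * r + p * q.
  by rewrite /GRing.scale /= addrC (mulrC r).
rewrite /acc /derive1n /= derive1E.
rewrite (near_eq_derive _ (derive1_test_curve v d l ax bx)).
have /is_derive_sum[_ <-] j : is_derive (0 : C) 1
    (fun t => partial a j (coordi b l) (test_curve a x v d t) *
             (v 0 j + 2 * t * d 0 j))
    ((\sum_i 'D_(delta_mx 0 i) (psi j) (coord a x) * v 0 i) * v 0 j
     + partial a j (coordi b l) x * (2 * d 0 j)).
  have dp := differentiable_parabola (coord a x) v d 0.
  have dpsi0 : differentiable (psi j) (parabola (coord a x) v d 0).
    by rewrite parabola0.
  have D1 : is_derive (0 : C) 1 (psi j \o parabola (coord a x) v d)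
      (\sum_i 'D_(delta_mx 0 i) (psi j) (coord a x) * v 0 i).
    apply: DeriveDef; first exact/diff_derivable/differentiable_comp.
    rewrite (derive_comp_row _ dp dpsi0) parabola0; apply: eq_bigr => i _.
    have [_ ->] := is_derive_parabola (coord a x) v d i 0.
    by rewrite mulr0 mul0r addr0.
  have D2 := is_derive_parabola_velocity v d j 0.
  have D3 := is_deriveM D1 D2.
  apply: is_derive_eq D3 _ => /=.
  rewrite mulr0 mul0r addr0 /test_curve parabola0 -psiE; exact: swap.
apply: (congr1 (fun F : C -> C => 'D_1 F 0)).
by apply/funext=> t; rewrite fct_sumE.
Qed.

End TestCurves.

(** * Binary forms *)

Section Forms.
Context (K : comNzRingType).

(** Coefficients are indexed by both exponents, as in [jet_expansion]; only the
values c p q with p + q = n matter. *)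
Definition binary_form n (c : nat -> nat -> K) (v0 v1 : K) : K :=
  \sum_(p < n.+1) c p (n - p)%N * v0 ^+ p * v1 ^+ (n - p).

Lemma binary_form0 c v0 v1 : binary_form 0 c v0 v1 = c 0 0.
Proof. by rewrite /binary_form big_ord1 !expr0 !mulr1. Qed.

Lemma binary_form_at0 n c v0 v1 :
  v0 = 0 -> v1 = 0 -> binary_form n.+1 c v0 v1 = 0.
Proof.
move=> -> ->; rewrite /binary_form big1 // => p _; case: (posnP p) => [->|p0].
  by rewrite subn0 [0 ^+ n.+1]expr0n mulr0.
by rewrite [0 ^+ p]expr0n gtn_eqF // mulr0 mul0r.
Qed.

Lemma antidiagonal_sum N n (F : nat -> nat -> K) : (n < N)%N ->
  \sum_(p < N) \sum_(q < N | (p + q == n)%N) F p q =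
  \sum_(p < n.+1) F p (n - p)%N.
Proof.
move=> nN; rewrite (big_ord_widen_cond N xpredT (fun p => F p (n - p)%N)) //.
rewrite [RHS]big_mkcond; apply: eq_bigr => p _ /=; rewrite ltnS.
case: leqP => pn.
  have qN : (n - p < N)%N by rewrite (leq_ltn_trans (leq_subr _ _)).
  rewrite (big_pred1 (Ordinal qN)) // => q /=.
  by rewrite -[RHS]val_eqE -{1}(subnKC pn) eqn_add2l.
rewrite big_pred0 // => q; apply/negbTE; apply: contraTN pn => /eqP <-.
by rewrite -leqNgt leq_addr.
Qed.

Lemma binary_formE N n (c : nat -> nat -> K) v0 v1 : (n < N)%N ->
  \sum_(p < N) \sum_(q < N | (p + q == n)%N) c p q * v0 ^+ p * v1 ^+ q =
  binary_form n c v0 v1.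
Proof. exact: (antidiagonal_sum (fun p q => c p q * v0 ^+ p * v1 ^+ q)). Qed.

Lemma binary_formM n m b c v0 v1 :
  binary_form n b v0 v1 * binary_form m c v0 v1 =
  binary_form (n + m) (fun r _ =>
    \sum_(p < n.+1) \sum_(q < m.+1 | (p + q == r)%N)
      b p (n - p)%N * c q (m - q)%N) v0 v1.
Proof.
rewrite /binary_form big_distrlr /=.
under [RHS]eq_bigr do rewrite 2!mulr_suml.
rewrite [RHS]exchange_big; apply: eq_bigr => p _ /=.
under [RHS]eq_bigr do rewrite 2!mulr_suml big_mkcond.
rewrite [RHS]exchange_big; apply: eq_bigr => q _ /=.
have pqn : (p + q < (n + m).+1)%N by rewrite ltnS leq_add // -ltnS.
rewrite -big_mkcond (big_pred1 (Ordinal pqn)) => [/=|r /=]; last first.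
  by rewrite -[RHS]val_eqE eq_sym.
have -> : (n + m - (p + q) = (n - p) + (m - q))%N.
  by have := ltn_ord p; have := ltn_ord q; lia.
by rewrite !exprD; ring.
Qed.

Lemma binary_formB n b c v0 v1 : binary_form n b v0 v1 - binary_form n c v0 v1 =
  binary_form n (fun p q => b p q - c p q) v0 v1.
Proof. by rewrite -sumrB; apply: eq_bigr => p _; rewrite !mulrBl. Qed.

Lemma binary_formZ n g c v0 v1 : g * binary_form n c v0 v1 =
  binary_form n (fun p q => g * c p q) v0 v1.
Proof. by rewrite mulr_sumr; apply: eq_bigr => p _; rewrite !mulrA. Qed.

(** As 3 j <= m <= 5 forces j <= 1, there are two terms. *)
Lemma jet_sum m (c : nat -> nat -> nat -> K) v0 v1 w : (3 <= m <= 5)%N ->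
  \sum_(p < m.+1) \sum_(q < m.+1) \sum_(j < m.+1 | (p + q + 3 * j == m)%N)
     c p q j * v0 ^+ p * v1 ^+ q * w ^+ j =
  binary_form m (fun p q => c p q 0%N) v0 v1 +
  binary_form (m - 3) (fun p q => c p q 1%N) v0 v1 * w.
Proof.
move=> m35; rewrite -!(@binary_formE m.+1) ?ltnS ?leq_subr //.
rewrite mulr_suml -big_split.
apply: eq_bigr => p _ /=; rewrite mulr_suml.
rewrite [X in _ = X + _]big_mkcond [X in _ = _ + X]big_mkcond -big_split.
apply: eq_bigr => q _ /=.
have w2 : (2 <= m.+1)%N by lia.
transitivity (\sum_(j < 2 | (p + q + 3 * j == m)%N)
  c p q j * v0 ^+ p * v1 ^+ q * w ^+ j).
  rewrite [RHS](big_ord_widen_cond m.+1 (fun j => (p + q + 3 * j == m)%N)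
     (fun j => c p q j * v0 ^+ p * v1 ^+ q * w ^+ j)) //.
  by apply: eq_bigl => j; lia.
rewrite big_mkcond big_ord_recl big_ord1 /= expr0 mulr1 expr1.
have -> : (p + q + 3 * 0 == m)%N = (p + q == m)%N by lia.
have -> // : (p + q + 3 * bump 0 0 == m)%N = (p + q == m - 3)%N.
by rewrite /bump /=; lia.
Qed.

End Forms.

Lemma det2 (K : comNzRingType) (A : 'M[K]_2) :
  \det A = A 0 0 * A 1 1 - A 0 1 * A 1 0.
Proof.
rewrite (expand_det_row _ 0) /cofactor !big_ord_recl !big_ord0.
rewrite !det_mx11 !mxE /=.
have -> : lift ord0 ord0 = 1 :> 'I_2 by apply/val_inj.
have -> : lift 1 0 = 0 :> 'I_2 by apply/val_inj.
have -> : ord0 = 0 :> 'I_2 by apply/val_inj.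
by rewrite /bump /=; ring.
Qed.

(** Here u_l = \sum_j J j l * v_j is the image of v by J, and the part linear
in d is 2 det (J v, J d) = 2 (det J) det (v, d). *)
Lemma cross_affine (K : comNzRingType) (J : 'I_2 -> 'I_2 -> K)
    (q0 q1 : 'I_2 -> K) (v d : 'rV[K]_2) :
  (\sum_j J j 0 * v 0 j) * (\sum_j (q1 j + J j 1 * (2 * d 0 j)))
  - (\sum_j (q0 j + J j 0 * (2 * d 0 j))) * (\sum_j J j 1 * v 0 j) =
  (\sum_j J j 0 * v 0 j) * (\sum_j q1 j)
  - (\sum_j q0 j) * (\sum_j J j 1 * v 0 j)
  + 2 * \det (\matrix_(j, l) J j l) * (v 0 0 * d 0 1 - d 0 0 * v 0 1).
Proof.
rewrite det2 !mxE !big_ord_recl !big_ord0 /=.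
have -> : lift ord0 ord0 = 1 :> 'I_2 by apply/val_inj.
have -> : ord0 = 0 :> 'I_2 by apply/val_inj.
by ring.
Qed.

(** * The coefficient of the Wronskian under a change of charts *)

Section WronskianCoefficient.
Context (R : realType) (X : surface R) (hX : projective_surface X).
Local Notation C := (complexes R).
Implicit Types (a b : chart X) (x : X) (v d : 'rV[C]_2).

Lemma vel_test_curve_same a x v d l : dom a x ->
  vel a (test_curve a x v d) l = v 0 l.
Proof.
move=> ax; rewrite (vel_test_curve hX _ _ _ ax ax) (bigD1 l) //=.
rewrite big1 => [|j jl].
  by rewrite (partial_coordi hX _ _ ax) eqxx mul1r addr0.
by rewrite (partial_coordi hX _ _ ax) eq_sym (negbTE jl) mul0r.
Qed.

Lemma jac_same a x : dom a x -> jac a a x = 1.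
Proof.
move=> ax; rewrite -(det1 _ 2); congr (\det _); apply/matrixP=> i j.
by rewrite !mxE (partial_coordi hX _ _ ax) eq_sym.
Qed.

(** The first jet of the test curve is fixed; w0 is its Wronskian in the chart
b when d = 0. *)
Lemma wronskian_test_curve a b x v : dom a x -> dom b x ->
  exists w0, forall d, wronskian b (test_curve a x v d) =
    w0 + 2 * jac a b x * (v 0 0 * d 0 1 - d 0 0 * v 0 1).
Proof.
move=> ax bx.
have [q0 E0] := acc_test_curve hX v 0 ax bx.
have [q1 E1] := acc_test_curve hX v 1 ax bx.
pose J j l := partial a j (coordi b l) x.
exists ((\sum_j J j 0 * v 0 j) * (\sum_j q1 j)
  - (\sum_j q0 j) * (\sum_j J j 1 * v 0 j)) => d.
rewrite /wronskian E0 E1 !(vel_test_curve hX _ _ _ ax bx).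
exact: (cross_affine J).
Qed.

(** Compare P = tau Q on the test curves with accelerations 0 and 2 d, where d
is not proportional to v: in the difference the terms A and A' cancel, and so
does the factor 2 det (v, d) afterwards. *)
Lemma wronskian_coefficient_neq0 a b x (P Q : operator X) (tau : C)
    (A A' : C -> C -> C) n (c c' : nat -> nat -> C) v :
  dom a x -> dom b x ->
  (forall f, is_curve f -> f 0 = x -> P f = A (vel a f 0) (vel a f 1) +
     binary_form n c (vel a f 0) (vel a f 1) * wronskian a f) ->
  (forall f, is_curve f -> f 0 = x -> Q f = A' (vel b f 0) (vel b f 1) +
     binary_form n c' (vel b f 0) (vel b f 1) * wronskian b f) ->
  (forall f, is_curve f -> f 0 = x -> P f = tau * Q f) ->
  v != 0 ->
  binary_form n c (v 0 0) (v 0 1) = tau * jac a b x *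
    binary_form n c' (\sum_j partial a j (coordi b 0) x * v 0 j)
              (\sum_j partial a j (coordi b 1) x * v 0 j).
Proof.
move=> ax bx EP EQ PQ v0.
have [wa Ea] := wronskian_test_curve v ax ax.
have [wb Eb] := wronskian_test_curve v ax bx.
have key d : A (v 0 0) (v 0 1) + binary_form n c (v 0 0) (v 0 1) *
    (wa + 2 * (v 0 0 * d 0 1 - d 0 0 * v 0 1)) =
  tau * (A' (\sum_j partial a j (coordi b 0) x * v 0 j)
            (\sum_j partial a j (coordi b 1) x * v 0 j) +
    binary_form n c' (\sum_j partial a j (coordi b 0) x * v 0 j)
              (\sum_j partial a j (coordi b 1) x * v 0 j) *
    (wb + 2 * jac a b x * (v 0 0 * d 0 1 - d 0 0 * v 0 1))).
  have f0 := test_curve0 hX v d ax.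
  have hf := test_curveP hX (v := v) (d := d) ax.
  have := PQ _ hf f0; rewrite EP // EQ // Ea Eb (jac_same ax) mulr1.
  by rewrite !(vel_test_curve_same _ _ _ ax) !(vel_test_curve hX _ _ _ ax bx).
have [d d0] : exists d : 'rV[C]_2, v 0 0 * d 0 1 - d 0 0 * v 0 1 != 0.
  have [v00|v00] := eqVneq (v 0 0) 0; last first.
    by exists (delta_mx 0 1); rewrite !mxE /= mulr1 mul0r subr0.
  exists (delta_mx 0 0); rewrite !mxE /= mulr0 mul1r sub0r oppr_eq0.
  apply: contraNneq v0 => v01; apply/eqP/rowP => j; rewrite mxE.
  case: j => -[|[|//]] ?; [rewrite -[RHS]v00 | rewrite -[RHS]v01];
    by congr (v 0 _); apply/val_inj.
move: (key 0) (key d); rewrite !mxE mulr0 mul0r subrr.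
move: (binary_form n c _ _) (binary_form n c' _ _) (jac a b x).
move: (A _ _) (A' _ _) d0.
move: (_ - _) => e a0 a0' e0 B B' J E1 E2.
have e2 : 2 * e != 0 by rewrite mulf_neq0 // pnatr_eq0.
apply: (mulIf e2).
transitivity ((a0 + B * (wa + 2 * e)) - (a0 + B * (wa + 2 * 0))); first by ring.
by rewrite E1 E2; ring.
Qed.

(** The velocity v of f may vanish.  Both forms are then zero when their degree
is positive; in degree 0 they are constant, so that v may be replaced by any
nonzero vector. *)
Lemma wronskian_coefficient a b x (P Q : operator X) (tau : C)
    (A A' : C -> C -> C) n (c c' : nat -> nat -> C) f :
  dom a x -> dom b x ->
  (forall f, is_curve f -> f 0 = x -> P f = A (vel a f 0) (vel a f 1) +
     binary_form n c (vel a f 0) (vel a f 1) * wronskian a f) ->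
  (forall f, is_curve f -> f 0 = x -> Q f = A' (vel b f 0) (vel b f 1) +
     binary_form n c' (vel b f 0) (vel b f 1) * wronskian b f) ->
  (forall f, is_curve f -> f 0 = x -> P f = tau * Q f) ->
  is_curve f -> f 0 = x ->
  binary_form n c (vel a f 0) (vel a f 1) =
  tau * jac a b x * binary_form n c' (vel b f 0) (vel b f 1).
Proof.
move=> ax bx EP EQ PQ hf f0.
have key v := wronskian_coefficient_neq0 (v := v) ax bx EP EQ PQ.
have ax' := ax; have bx' := bx; rewrite -f0 in ax' bx'.
pose v : 'rV[C]_2 := \row_j vel a f j.
have vE j : v 0 j = vel a f j by rewrite mxE.
have uE l : vel b f l = \sum_j partial a j (coordi b l) x * v 0 j.
  by rewrite (vel_change hX l hf ax' bx') f0; apply: eq_bigr => j _; rewrite vE.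
rewrite 2!uE -2!vE.
have [v0|] := eqVneq v 0; last exact: key.
case: n c c' EP EQ key => [|n] c c' _ _ key.
  have := key (delta_mx 0 0); rewrite !binary_form0; apply.
  by apply/negP => /eqP/rowP/(_ 0)/eqP; rewrite !mxE /= oner_eq0.
have s0 l : \sum_j partial a j (coordi b l) x * v 0 j = 0.
  by rewrite big1 // => j _; rewrite v0 mxE mulr0.
have v_eq0 l : v 0 l = 0 by rewrite v0 mxE.
rewrite (binary_form_at0 _ _ (s0 0) (s0 1)).
by rewrite (binary_form_at0 _ _ (v_eq0 0) (v_eq0 1)) mulr0.
Qed.

End WronskianCoefficient.

(** * Holomorphic functions and rational multiples of a divisor *)

Section Holomorphic.
Context (R : realType) (X : surface R).
Local Notation C := (complexes R).
Implicit Types (U V : set X) (g h : X -> C).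

Lemma holo_subset U V g : U `<=` V -> holo V g -> holo U g.
Proof. by move=> UV hg a x Ux; apply: hg; exact: UV. Qed.

Lemma holo_cst U (c : C) : holo U (fun=> c).
Proof. by move=> a x _ _; exact: differentiable_cst. Qed.

Lemma holoD U g h : holo U g -> holo U h -> holo U (fun x => g x + h x).
Proof.
move=> hg hh a x Ux ax.
exact: differentiableD (hg a x Ux ax) (hh a x Ux ax).
Qed.

Lemma holoB U g h : holo U g -> holo U h -> holo U (fun x => g x - h x).
Proof.
move=> hg hh a x Ux ax.
exact: differentiableB (hg a x Ux ax) (hh a x Ux ax).
Qed.

Lemma holoM U g h : holo U g -> holo U h -> holo U (fun x => g x * h x).
Proof.
move=> hg hh a x Ux ax.
exact: differentiableM (hg a x Ux ax) (hh a x Ux ax).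
Qed.

Lemma holoX U g n : holo U g -> holo U (fun x => g x ^+ n).
Proof.
move=> hg; elim: n => [|n IHn]; first exact: holo_cst.
by have := holoM hg IHn; congr (holo U _); apply/funext=> x; rewrite exprS.
Qed.

Lemma holo_sum U I (r : seq I) (P : pred I) (g : I -> X -> C) :
  (forall i, P i -> holo U (g i)) ->
  holo U (fun x => \sum_(i <- r | P i) g i x).
Proof.
move=> hg; elim: r => [|i r IHr].
  have := holo_cst (U := U) 0; congr (holo U _).
  by apply/funext=> x; rewrite big_nil.
case Pi: (P i).
  have := holoD (hg i Pi) IHr; congr (holo U _).
  by apply/funext=> x; rewrite big_cons Pi.
by move: IHr; congr (holo U _); apply/funext=> x; rewrite big_cons Pi.
Qed.

Lemma holo_unit_subset U V u : U `<=` V -> holo_unit V u -> holo_unit U u.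
Proof.
by move=> UV [hu u0]; split=> [|x /UV]; [exact: holo_subset hu | exact: u0].
Qed.

Lemma holo_unitM U u v :
  holo_unit U u -> holo_unit U v -> holo_unit U (fun x => u x * v x).
Proof.
move=> [hu u0] [hv v0]; split; first exact: holoM.
by move=> x Ux; rewrite mulf_neq0 ?u0 ?v0.
Qed.

Lemma holo_unitX U u n : holo_unit U u -> holo_unit U (fun x => u x ^+ n).
Proof.
move=> [hu u0]; split; first exact: holoX.
by move=> x Ux; rewrite expf_neq0 ?u0.
Qed.

Context (hX : projective_surface X).

Lemma holo_jac (a b : chart X) : holo (dom a `&` dom b) (jac a b).
Proof.
have hp j l : holo (dom a `&` dom b) (partial a j (coordi b l)).
  exact: surf_holo_partial.
have := holoB (holoM (hp 0 0) (hp 1 1)) (holoM (hp 0 1) (hp 1 0)).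
by congr (holo _ _); apply/funext=> x; rewrite /jac det2 4!mxE.
Qed.

Lemma holo_unit_jac (a b : chart X) : holo_unit (dom a `&` dom b) (jac a b).
Proof.
split; first exact: holo_jac.
move=> x [ax bx]; have := jacM hX ax bx.
by apply: contra_eq_neq => ->; rewrite mul0r eq_sym oner_eq0.
Qed.

(** The continuity of g yields a nonempty open set where g does not vanish, on
which the hypothesis on h applies. *)
Lemma nowhere_zero_germM U g h : open U -> holo U g ->
  nowhere_zero_germ U g -> nowhere_zero_germ U h ->
  nowhere_zero_germ U (fun x => g x * h x).
Proof.
move=> oU hg g0 h0 V oV VU Vn0; have [x Vx gx] := g0 V oV VU Vn0.
have cg := holo_continuous hX oU hg (VU _ Vx).
have : nbhs x (fun y => V y /\ g y != 0).
  near=> y; split; near: y; first exact: open_nbhs_nbhs.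
  exact: (cvgr_neq0 _ cg gx).
rewrite nbhsE => -[W [oW Wx] WV].
have [|//|y Wy hy] := h0 W oW _ _; first by move=> y /WV[/VU].
  by exists x.
by have [Vy gy] := WV _ Wy; exists y; rewrite ?mulf_neq0.
Unshelve. all: by end_near. Qed.

Lemma nowhere_zero_germ_subset U V g :
  U `<=` V -> nowhere_zero_germ V g -> nowhere_zero_germ U g.
Proof. by move=> UV g0 W oW WU; apply: g0 => //; exact: subset_trans UV. Qed.

Lemma canonical_is_divisor (w : mero_form X) :
  is_mero_form w -> is_divisor (canonical_divisor w).
Proof.
move=> hw; split; [exact: form_open hw|exact: form_cover hw
  |exact: form_num_holo hw|exact: form_den_holo hw|exact: form_num_neq0 hw
  |exact: form_den_neq0 hw| |exact: form_trE hw] => k l /=.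
have := holo_unit_jac (wchart k) (wchart l); apply: holo_unit_subset.
by apply: setISS => x; exact: (form_chart hw).
Qed.

Lemma div_add_is_divisor (D E : divisor X) :
  is_divisor D -> is_divisor E -> is_divisor (div_add D E).
Proof.
move=> hD hE.
have oI p : open (dcov (d := div_add D E) p).
  by apply: openI; [exact: div_open hD _ | exact: div_open hE _].
have subl (p : didx (div_add D E)) : dcov p `<=` dcov (d := D) p.1.
  by move=> x [].
have subr (p : didx (div_add D E)) : dcov p `<=` dcov (d := E) p.2.
  by move=> x [].
split; rewrite /=.
- exact: oI.
- move=> x; have [i Di] := div_cover hD x; have [j Ej] := div_cover hE x.
  by exists (i, j).
- move=> p; apply: holoM.
  + exact: holo_subset (@subl p) (div_num_holo hD (i := p.1)).
  + exact: holo_subset (@subr p) (div_num_holo hE (i := p.2)).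
- move=> p; apply: holoM.
  + exact: holo_subset (@subl p) (div_den_holo hD (i := p.1)).
  + exact: holo_subset (@subr p) (div_den_holo hE (i := p.2)).
- move=> p; apply: nowhere_zero_germM.
  + exact: oI.
  + exact: holo_subset (@subl p) (div_num_holo hD (i := p.1)).
  + exact: nowhere_zero_germ_subset (@subl p) (div_num_neq0 hD (i := p.1)).
  + exact: nowhere_zero_germ_subset (@subr p) (div_num_neq0 hE (i := p.2)).
- move=> p; apply: nowhere_zero_germM.
  + exact: oI.
  + exact: holo_subset (@subl p) (div_den_holo hD (i := p.1)).
  + exact: nowhere_zero_germ_subset (@subl p) (div_den_neq0 hD (i := p.1)).
  + exact: nowhere_zero_germ_subset (@subr p) (div_den_neq0 hE (i := p.2)).
- move=> p q; apply: holo_unitM.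
  + exact: holo_unit_subset (setISS (@subl p) (@subl q)) (div_tr_unit hD _ _).
  + exact: holo_unit_subset (setISS (@subr p) (@subr q)) (div_tr_unit hE _ _).
- move=> p q x [pD pE] [qD qE].
  rewrite mulrACA (div_trE hD pD qD) (div_trE hE pE qE).
  by ring.
Qed.

Lemma rat_multiple_refl (K : divisor X) : is_divisor K -> rat_multiple 1 K K.
Proof.
move=> hK; split=> //; exists 1, 1%N; split=> // i j.
exists (dtr i j); first exact: (div_tr_unit hK).
by move=> x ix jx /=; rewrite !expr1; exact: (div_trE hK).
Qed.

Lemma nonneg_numerator (p : int) (q : nat) :
  (0 < q)%N -> 0 <= p%:~R / q%:R :> rat -> exists n : nat, p = n%:Z.
Proof.
move=> q0; rewrite pmulr_lge0 ?invr_gt0 ?ltr0n // ler0z.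
by case: p => // n _; exists n.
Qed.

(** If q1 D = p1 K and q2 E = p2 K with q1, q2 > 0, then
q1 q2 (D + E) = (p1 q2 + p2 q1) K.  Nonnegativity of s and t makes p1 and p2
natural numbers, so only powers with natural exponents occur. *)
Lemma rat_multiple_add (K D E : divisor X) (s t : rat) : 0 <= s -> 0 <= t ->
  rat_multiple s K D -> rat_multiple t K E ->
  rat_multiple (s + t) K (div_add D E).
Proof.
move=> s0 t0 [hD [p1 [q1 [q1_gt0 s1 eqD]]]] [hE [p2 [q2 [q2_gt0 t2 eqE]]]].
split; first exact: div_add_is_divisor.
rewrite s1 in s0 *; rewrite t2 in t0 *.
have [n1 p1E] := nonneg_numerator q1_gt0 s0.
have [n2 p2E] := nonneg_numerator q2_gt0 t0.
rewrite p1E in eqD *; rewrite p2E in eqE *.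
exists (n1 * q2 + n2 * q1)%N%:Z, (q1 * q2)%N; split.
- by rewrite muln_gt0 q1_gt0.
- have q1n0 : q1%:R != 0 :> rat by rewrite pnatr_eq0 -lt0n.
  have q2n0 : q2%:R != 0 :> rat by rewrite pnatr_eq0 -lt0n.
  by rewrite -!pmulrn natrD !natrM; field; rewrite q1n0 q2n0.
- move=> p k; have [u hu eu] := eqD p.1 k; have [v hv ev] := eqE p.2 k.
  exists (fun x => u x ^+ q2 * v x ^+ q1).
    apply: holo_unitM; apply: holo_unitX.
    + by apply: (holo_unit_subset _ hu) => x [[]].
    + by apply: (holo_unit_subset _ hv) => x [[]].
  move=> x [pD pE] kx; have := eu x pD kx; have := ev x pE kx.
  rewrite /= => E2 E1.
  rewrite !exprMn !exprD !exprM.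
  rewrite ![_ ^+ q1 ^+ q2 * _ ^+ q1 ^+ q2 * _]mulrACA.
  rewrite [dnum p.2 x ^+ q1 ^+ q2]exprAC [dden p.2 x ^+ q1 ^+ q2]exprAC.
  rewrite -!exprMn E1 E2 !exprMn; ring.
Qed.

End Holomorphic.

(** * The bracket is a symmetric differential *)

Section Bracket.
Context (R : realType) (X : surface R) (hX : projective_surface X).
Local Notation C := (complexes R).
Implicit Types (a b : chart X) (U : set X) (P Q : operator X).

(** A section over U of the n-th symmetric power of the cotangent bundle, read
in the chart a. *)
Definition homogeneous_operator n a U P :=
  exists2 c : nat -> nat -> X -> C,
    (forall p q, holo (U `&` dom a) (c p q)) &
    forall f, is_curve f -> U (f 0) -> dom a (f 0) ->
      P f = binary_form n (fun p q => c p q (f 0)) (vel a f 0) (vel a f 1).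

Lemma homogeneous_operatorM n m a U P Q :
  homogeneous_operator n a U P -> homogeneous_operator m a U Q ->
  homogeneous_operator (n + m) a U (fun f => P f * Q f).
Proof.
move=> [b hb EP] [c hc EQ].
exists (fun r _ x => \sum_(p < n.+1) \sum_(q < m.+1 | (p + q == r)%N)
      b p (n - p)%N x * c q (m - q)%N x).
  by move=> r _; apply: holo_sum => p _; apply: holo_sum => q _; apply: holoM.
by move=> f hf Uf af; rewrite EP // EQ // binary_formM.
Qed.

Lemma homogeneous_operatorB n a U P Q :
  homogeneous_operator n a U P -> homogeneous_operator n a U Q ->
  homogeneous_operator n a U (fun f => P f - Q f).
Proof.
move=> [b hb EP] [c hc EQ]; exists (fun p q x => b p q x - c p q x).
  by move=> p q; apply: holoB.
by move=> f hf Uf af; rewrite EP // EQ // binary_formB.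
Qed.

Lemma homogeneous_operatorZ n a U (g : X -> C) P :
  holo (U `&` dom a) g -> homogeneous_operator n a U P ->
  homogeneous_operator n a U (fun f => g (f 0) * P f).
Proof.
move=> hg [c hc EP]; exists (fun p q x => g x * c p q x).
  by move=> p q; apply: holoM.
by move=> f hf Uf af; rewrite EP // binary_formZ.
Qed.

Lemma homogeneous_jet_expansion m a U P : homogeneous_operator m a U P ->
  exists2 c, jet_expansion m a U c P &
    forall p q j x, (0 < j)%N -> c p q j x = 0.
Proof.
move=> [c hc EP].
exists (fun p q j => if j is 0%N then c p q else fun=> 0).
  split=> [p q [|j]|f hf Uf af]; [exact: hc|exact: holo_cst|].
  rewrite EP // -(@binary_formE _ m.+1) //; apply: eq_bigr => p _.
  rewrite big_mkcond; apply: eq_bigr => q _.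
  rewrite big_mkcond big_ord_recl /= big1 => [|j _]; last first.
    by rewrite !mul0r if_same.
  by rewrite addr0 expr0 mulr1 muln0 addn0.
by move=> p q [|j] x.
Qed.

Lemma jet_expansion_split m a U c P f : (3 <= m <= 5)%N ->
  jet_expansion m a U c P -> is_curve f -> U (f 0) -> dom a (f 0) ->
  P f = binary_form m (fun p q => c p q 0%N (f 0)) (vel a f 0) (vel a f 1) +
    binary_form (m - 3) (fun p q => c p q 1%N (f 0)) (vel a f 0) (vel a f 1)
      * wronskian a f.
Proof.
move=> m35 [_ EP] hf Uf af; rewrite EP //.
exact: (jet_sum (fun p q j => c p q j (f 0))).
Qed.

(** The definition of Phi reads beta (k, i) in the chart of the k-th piece of
the canonical divisor; this expresses it through an expansion, in any chart a,
of any operator Q proportional to P i at the point considered. *)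
Lemma is_Phi_transition m (w : mero_form X) (D : divisor X)
    (P : lb_idx (OO D) -> operator X)
    (beta : lb_idx (OO (div_add (canonical_divisor w) D)) -> operator X)
    (k : widx w) (i : didx D) a U c Q (tau : C) f :
  (3 <= m <= 5)%N -> is_mero_form w -> is_Phi m P beta ->
  jet_expansion m a U c Q ->
  is_curve f -> wcov k (f 0) -> dcov i (f 0) -> U (f 0) -> dom a (f 0) ->
  (forall g, is_curve g -> g 0 = f 0 -> P i g = tau * Q g) ->
  beta (k, i) f = tau * jac (wchart k) a (f 0) *
    binary_form (m - 3) (fun p q => c p q 1%N (f 0)) (vel a f 0) (vel a f 1).
Proof.
move=> m35 hw hPhi hc hf kf iF Uf af PQ.
have [b hb ->] // := hPhi k i.
have kdom := form_chart hw kf.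
apply: etrans (binary_formE (fun p q => b p q 1%N (f 0)) _ _ (ltnSn _)) _.
apply: (wronskian_coefficient hX (P := P i) (Q := Q)
  (A := binary_form m (fun p q => b p q 0%N (f 0)))
  (A' := binary_form m (fun p q => c p q 0%N (f 0))) kdom af) => //.
- move=> g hg g0; rewrite -g0.
  by apply: (jet_expansion_split m35 hb hg); rewrite g0.
- move=> g hg g0; rewrite -g0.
  by apply: (jet_expansion_split m35 hc hg); rewrite g0.
Qed.

(** The transition function of O(K_X + D) is the product of a Jacobian, due to
the change of charts, and of the transition function of O(D), due to P. *)
Lemma glued_Phi m (w : mero_form X) (D : divisor X)
    (P : lb_idx (OO D) -> operator X)
    (beta : lb_idx (OO (div_add (canonical_divisor w) D)) -> operator X) :
  (3 <= m <= 5)%N -> is_mero_form w -> glued P -> is_Phi m P beta ->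
  glued beta.
Proof.
move=> m35 hw gP hPhi [k i] [l j] f hf [/= kf iF] [/= lf jf].
have [c hc Ebeta] := hPhi l j.
have ldom := form_chart hw lf.
rewrite (is_Phi_transition (i := i) (tau := dtr i j (f 0)) m35 hw hPhi hc hf
  kf iF (conj lf jf) ldom); last first.
  by move=> g hg g0; rewrite -g0; apply: gP; rewrite ?g0.
rewrite [dtr i j _ * _]mulrC; congr (_ * _).
apply: esym; apply: etrans (Ebeta f hf lf jf) _.
exact: (binary_formE (fun p q => c p q 1%N (f 0)) _ _ (ltnSn _)).
Qed.

(** In a chart, with J the Jacobian relating it to that of the canonical
divisor, the bracket is J B1 (A2 + B2 W) - J B2 (A1 + B1 W), where W cancels. *)
Lemma Phi_bracket_symmetric m1 m2 (w : mero_form X) (D1 D2 : divisor X)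
    (P1 : lb_idx (OO D1) -> operator X) (P2 : lb_idx (OO D2) -> operator X)
    (beta1 : lb_idx (OO (div_add (canonical_divisor w) D1)) -> operator X)
    (beta2 : lb_idx (OO (div_add (canonical_divisor w) D2)) -> operator X) :
  (3 <= m1 <= 5)%N -> (3 <= m2 <= 5)%N -> is_mero_form w ->
  H0_E m1 (OO D1) P1 -> H0_E m2 (OO D2) P2 ->
  is_Phi m1 P1 beta1 -> is_Phi m2 P2 beta2 ->
  H0_S (m1 + m2 - 3) (OO (div_add (div_add (canonical_divisor w) D1) D2))
    (Phi_bracket P1 P2 beta1 beta2).
Proof.
move=> m1_35 m2_35 hw [gP1 eP1] [gP2 eP2] hPhi1 hPhi2; split.
  move=> [[k i] j] [[k' i'] j'] f hf [/= [kf iF] jf] [/= [kf' if'] jf'].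
  have E1 := glued_Phi m1_35 hw gP1 hPhi1 (i := (k, i)) (j := (k', i')) hf
    (conj kf iF) (conj kf' if').
  have E2 := glued_Phi m2_35 hw gP2 hPhi2 (i := (k, j)) (j := (k', j')) hf
    (conj kf jf) (conj kf' jf').
  rewrite E1 E2 (gP1 i i') // (gP2 j j') //=; ring.
move=> [[k i] j] a; apply: homogeneous_jet_expansion.
have [c1 hc1] := eP1 i a; have [c2 hc2] := eP2 j a.
pose U := (wcov k `&` dcov i) `&` dcov j.
have Ui : U `&` dom a `<=` dcov i `&` dom a by move=> x [[[]]].
have Uj : U `&` dom a `<=` dcov j `&` dom a by move=> x [[[]]].
pose F n (c : nat -> nat -> nat -> X -> C) e : operator X := fun f =>
  binary_form n (fun p q => c p q e (f 0)) (vel a f 0) (vel a f 1).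
have hF1 n e : homogeneous_operator n a U (F n c1 e).
  exists (fun p q => c1 p q e) => // p q.
  exact: holo_subset Ui (hc1.1 p q e).
have hF2 n e : homogeneous_operator n a U (F n c2 e).
  exists (fun p q => c2 p q e) => // p q.
  exact: holo_subset Uj (hc2.1 p q e).
have hJ : holo (U `&` dom a) (jac (wchart k) a).
  have := holo_jac hX (a := wchart k) (b := a).
  apply: holo_subset => x [[[kx _] _] ax].
  exact: (conj (form_chart hw kx) ax).
have := homogeneous_operatorM (hF1 (m1 - 3)%N 1%N) (hF2 m2 0%N).
have := homogeneous_operatorM (hF2 (m2 - 3)%N 1%N) (hF1 m1 0%N).
have -> : (m2 - 3 + m1 = m1 + m2 - 3)%N by lia.
have -> : (m1 - 3 + m2 = m1 + m2 - 3)%N by lia.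
move=> h2 h1.
have [c hc Ec] := homogeneous_operatorZ hJ (homogeneous_operatorB h1 h2).
exists c => // f hf Uf af; rewrite -Ec //; case: Uf => [[kf iF] jf].
have B1 : beta1 (k, i) f = jac (wchart k) a (f 0) * F (m1 - 3)%N c1 1%N f.
  rewrite (is_Phi_transition (tau := 1) m1_35 hw hPhi1 hc1 hf kf iF iF af).
    by rewrite mul1r.
  by move=> g _ _; rewrite mul1r.
have B2 : beta2 (k, j) f = jac (wchart k) a (f 0) * F (m2 - 3)%N c2 1%N f.
  rewrite (is_Phi_transition (tau := 1) m2_35 hw hPhi2 hc2 hf kf jf jf af).
    by rewrite mul1r.
  by move=> g _ _; rewrite mul1r.
have A1 : P1 i f = F m1 c1 0%N f + F (m1 - 3)%N c1 1%N f * wronskian a f.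
  exact: (jet_expansion_split m1_35 hc1 hf iF af).
have A2 : P2 j f = F m2 c2 0%N f + F (m2 - 3)%N c2 1%N f * wronskian a f.
  exact: (jet_expansion_split m2_35 hc2 hf jf af).
rewrite /Phi_bracket B1 B2 A1 A2.
move: (jac _ _ _) (wronskian _ _).
move: (F _ _ _ _) (F _ _ _ _) (F _ _ _ _) (F _ _ _ _).
by move=> *; ring.
Qed.

End Bracket.

Theorem mainTheorem4 (R : realType) (X : surface R)
  (hX : projective_surface X) (hgt : general_type X)
  (w : mero_form X) (hw : is_mero_form w)
  (m1 m2 : nat) (hm1 : (3 <= m1 <= 5)%N) (hm2 : (3 <= m2 <= 5)%N)
  (t1 t2 : rat) (ht1 : 0 <= t1) (ht2 : 0 <= t2)
  (D1 D2 : divisor X)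
  (hD1 : rat_multiple t1 (canonical_divisor w) D1)
  (hD2 : rat_multiple t2 (canonical_divisor w) D2)
  (theta : rat)
  (htheta : is_theta1 (canonical_divisor w) (m1 + m2 - 3) theta)
  (hlt : 1 + t1 + t2 < (m1 + m2 - 3)%:R * theta)
  (P1 : lb_idx (OO D1) -> operator X) (hP1 : H0_E m1 (OO D1) P1)
  (P2 : lb_idx (OO D2) -> operator X) (hP2 : H0_E m2 (OO D2) P2)
  (beta1 : lb_idx (OO (div_add (canonical_divisor w) D1)) -> operator X)
  (hbeta1 : is_Phi m1 P1 beta1)
  (beta2 : lb_idx (OO (div_add (canonical_divisor w) D2)) -> operator X)
  (hbeta2 : is_Phi m2 P2 beta2) :
  zero_section (Phi_bracket P1 P2 beta1 beta2).
Proof.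
apply: contrapT => bracket_neq0.
have m_gt0 : 0 < (m1 + m2 - 3)%:R :> rat by rewrite ltr0n; lia.
have hK := rat_multiple_refl (canonical_is_divisor hX hw).
have hKD1 := rat_multiple_add hX ler01 ht1 hK hD1.
have hD := rat_multiple_add hX (addr_ge0 ler01 ht1) ht2 hKD1 hD2.
have /(htheta.2) :
    has_sym_section (canonical_divisor w) (m1 + m2 - 3) (1 + t1 + t2).
  exists (div_add (div_add (canonical_divisor w) D1) D2) => //.
  exists (Phi_bracket P1 P2 beta1 beta2) => //.
  exact: Phi_bracket_symmetric.
by rewrite ler_pdivlMr // mulrC leNgt hlt.
Qed.
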